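(* Let $k\ge 4$ and $n\ge 2$ be integers and assume that at least one of these two inequalities is strict. Then for any $0<\alpha\le 1$ there exists a non-negative function in $C^{k,\alpha}(\mathbb{R}^n)$ which cannot be written as a finite sum of squares of functions in $C^{\frac{k+\alpha}{2}}(\mathbb{R}^n)$.
   Context: All functions are real-valued. For an integer $k\ge 0$ and $0<\alpha\le 1$, $C^{k,\alpha}(\mathbb{R}^n)$ is the set of $k$-times continuously differentiable functions $f$ on $\mathbb{R}^n$ with $\sup_{x\ne y}\frac{|\partial^\beta f(x)-\partial^\beta f(y)|}{|x-y|^\alpha}<\infty$ for every multi-index $\beta$ with $|\beta|=k$. The half-regular space is $$C^{\frac{k+\alpha}{2}}(\mathbb{R}^n)=\begin{cases} C^{\frac{k}{2},\frac{\alpha}{2}}(\mathbb{R}^n) & k \text{ even},\\ C^{\frac{k-1}{2},\frac{1+\alpha}{2}}(\mathbb{R}^n) & k\text{ odd}.\end{cases}$$ *)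

(* Defs.v *)
From mathcomp Require Import all_boot all_order all_algebra.
From mathcomp Require Import all_classical all_reals topology normedtype derive exp.

Set Implicit Arguments.
Unset Strict Implicit.
Unset Printing Implicit Defensive.

Import Order.TTheory GRing.Theory Num.Theory.
Import numFieldNormedType.Exports.

Local Open Scope ring_scope.

(* The library norm on ['rV[R]_n] is the sup norm (it induces the usual
   topology); Hölder quotients use the Euclidean norm below. *)
Definition enorm (R : realType) (n : nat) (x : 'rV[R]_n) : R :=
  Num.sqrt (\sum_(i < n) x ord0 i ^+ 2).

Definition partial (R : realType) (n : nat) (i : 'I_n) (f : 'rV[R]_n -> R) :
    'rV[R]_n -> R :=
  fun x => 'D_(delta_mx ord0 i) f x.

(* [partials [:: i1; ...; im] f] is d_i1 (d_i2 (... (d_im f))). *)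
Definition partials (R : realType) (n : nat) (s : seq 'I_n)
    (f : 'rV[R]_n -> R) : 'rV[R]_n -> R :=
  foldr (@partial R n) f s.

Definition multi_index (n : nat) := {ffun 'I_n -> nat}.

Definition mdeg (n : nat) (b : multi_index n) : nat := (\sum_(i < n) b i)%N.

(* d_0^(b 0) d_1^(b 1) ... d_(n-1)^(b (n-1)) f *)
Definition mpartial (R : realType) (n : nat) (b : multi_index n)
    (f : 'rV[R]_n -> R) : 'rV[R]_n -> R :=
  partials (flatten [seq nseq (b i) i | i <- enum 'I_n]) f.

(* All iterated partial derivatives up to order k, in any order of
   differentiation, exist everywhere and are continuous.  Existence is stated
   separately because ['D_v f x] is total. *)
Definition cont_diff (R : realType) (n k : nat) (f : 'rV[R]_n -> R) : Prop :=
  (forall (s : seq 'I_n) (i : 'I_n) (x : 'rV[R]_n), (size s < k)%N ->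
     derivable (partials s f) x (delta_mx ord0 i)) /\
  (forall s : seq 'I_n, (size s <= k)%N -> continuous (partials s f)).

Definition holder_bounded (R : realType) (n : nat) (a : R)
    (g : 'rV[R]_n -> R) : Prop :=
  exists M : R, forall x y : 'rV[R]_n, x <> y ->
    `|g x - g y| / enorm (x - y) `^ a <= M.

Definition holder_space (R : realType) (n k : nat) (a : R)
    (f : 'rV[R]_n -> R) : Prop :=
  cont_diff k f /\
  (forall b : multi_index n, mdeg b = k -> holder_bounded a (mpartial b f)).

Definition half_regular (R : realType) (n k : nat) (a : R)
    (f : 'rV[R]_n -> R) : Prop :=
  if odd k then holder_space ((k - 1) %/ 2)%N ((1 + a) / 2%:R) f
  else holder_space (k %/ 2)%N (a / 2%:R) f.

Definition finite_sum_of_squares (R : realType) (n : nat)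
    (P : ('rV[R]_n -> R) -> Prop) (f : 'rV[R]_n -> R) : Prop :=
  exists (m : nat) (g : 'I_m -> 'rV[R]_n -> R),
    (forall j, P (g j)) /\ (forall x, f x = \sum_(j < m) g j x ^+ 2).

(* Main.v *)
(* Half-regular functions g satisfy, uniformly in the base point z,
     (Delta_p Delta_q g)(z + h) - (Delta_p Delta_q g)(z) = O(t^(2 + b))
   for coordinate steps p, q of length t and |h| <= 2 t.  For k = 4, 5 this is
   the Holder condition on the second derivatives; for k >= 6, g is bounded (as
   g^2 <= f) with a top derivative of bounded oscillation, so the intermediate
   derivatives are bounded and b = 1 is allowed.  By Cauchy-Schwarz, a sum of
   squares f then satisfies, with S the other points occurring in the difference,
     f(top) <= #(S u {error}) * (sum_S f + C t^(d + a)),   d = min(k, 5).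

   For k = 4, n >= 3 the points form a cube of side t, and the quartic
   [cube_poly], with w = t, equals t^4 at seven vertices and 61 t^4 at the
   eighth, while 61 > 8 * 7.  For k >= 5, n >= 2 take h = p + q: the values at
   z + p + q cancel and six points on the ellipse x^2 - x y + y^2 = t^2 remain.
   Up to o(t^5), [hexagon_poly], with w = t, equals t^5 at five of them and
   37 t^5 at the sixth, while 37 > 6 * 5.

   To meet arbitrarily small t within a single function without cut-offs,
   substitute sines of the coordinates for the variables and 1 / (1 + x_0^2) for
   w: near x_0 = 2 pi N the function looks like the polynomial at scale
   t = 1 / (1 + (2 pi N)^2).  All derivatives of the result are bounded, hence it
   lies in every C^(k, a). *)
Require Import Defs.
From mathcomp Require Import all_boot all_order all_algebra.
From mathcomp Require Import all_classical all_reals topology normedtype derive exp.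
From mathcomp Require Import sequences trigo realfun.
From mathcomp Require Import ring lra zify.
Import Order.TTheory GRing.Theory Num.Theory.
Import numFieldNormedType.Exports.
Local Open Scope ring_scope.

Set Implicit Arguments.
Unset Strict Implicit.
Unset Printing Implicit Defensive.

(** * Iterated finite differences and their relation to partial derivatives *)

Section Differences.
Variables (R : realType) (n : nat).
Implicit Types (f g : 'rV[R]_n -> R) (s : seq 'I_n) (x y z : 'rV[R]_n) (t : R).

Definition basis (i : 'I_n) : 'rV[R]_n := delta_mx ord0 i.

Definition fdiff t (i : 'I_n) f : 'rV[R]_n -> R :=
  fun x => f (x + t *: basis i) - f x.

Definition fdiffs t s f : 'rV[R]_n -> R := foldr (fdiff t) f s.

(** The existence clause of [cont_diff], isolated so that inductions can pass from [f] to
    [fdiff t i f]. *)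
Definition derivable_upto k f :=
  forall s i x, (size s < k)%N -> derivable (partials s f) x (basis i).

Lemma fdiffC t i j f : fdiff t i (fdiff t j f) = fdiff t j (fdiff t i f).
Proof.
apply/funext => x; rewrite /fdiff [x + _ + _]addrAC; ring.
Qed.

Lemma fdiffsC t i s f : fdiff t i (fdiffs t s f) = fdiffs t s (fdiff t i f).
Proof. by elim: s => //= j s IH; rewrite fdiffC IH. Qed.

(** Differences commute by algebra alone; the symmetry of partial derivatives is deduced from
    this. *)
Lemma fdiffs_perm t s s' f : perm_eq s s' -> fdiffs t s f = fdiffs t s' f.
Proof.
elim: s s' => [|i s IH] s'; first by rewrite perm_sym => /perm_nilP ->.
move=> ss'; have is' : i \in s' by rewrite -(perm_mem ss') mem_head.
case/splitPr: s' / is' ss' => s1 s2 ss'.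
have /IH/= -> : perm_eq s (s1 ++ s2).
  by rewrite -(perm_cons i) (perm_trans ss')// perm_sym -cat1s -[i :: s2]cat1s perm_catCA.
by rewrite /fdiffs !foldr_cat /= -!/(fdiffs _ _ _) -fdiffsC.
Qed.

Lemma is_derive_line f x i d :
  is_derive (0 : R) (1 : R) (fun t : R => f (x + t *: basis i)) d -> is_derive x (basis i) f d.
Proof.
have E : (fun h : R => h^-1 *: (((fun t => f (x + t *: basis i)) \o shift 0) (h *: 1)
     - f (x + 0 *: basis i)))
     = (fun h => h^-1 *: ((f \o shift x) (h *: basis i) - f x)).
  by apply/funext => h /=; rewrite addr0 scale0r addr0 [h *: 1]mulr1 [x + _]addrC.
by case=> d1 d2; split; move: d1 d2; rewrite /derivable /derive E.
Qed.

Lemma is_derive_along f x i t :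
  derivable f (x + t *: basis i) (basis i) ->
  is_derive t (1 : R) (fun u : R => f (x + u *: basis i)) ('D_(basis i) f (x + t *: basis i)).
Proof.
have E : (fun h : R => h^-1 *: (((fun u => f (x + u *: basis i)) \o shift t) (h *: 1)
     - f (x + t *: basis i)))
     = (fun h => h^-1 *: ((f \o shift (x + t *: basis i)) (h *: basis i)
     - f (x + t *: basis i))).
  by apply/funext => h /=; rewrite [h *: 1]mulr1 scalerDl addrCA.
by move=> d1; split; move: d1; rewrite /derivable /derive E.
Qed.

Lemma mvt_basis f i t x : 0 < t ->
  (forall y, derivable f y (basis i)) ->
  exists2 u, 0 <= u <= t &
    f (x + t *: basis i) - f x = t * 'D_(basis i) f (x + u *: basis i).
Proof.
move=> t0 df.
have D (u : R) : is_derive u (1 : R) (fun v : R => f (x + v *: basis i)) ('D_(basis i) f (x + u *: basis i)).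
  exact: is_derive_along.
have [|u] := @MVT _ (fun v => f (x + v *: basis i))
  (fun u => 'D_(basis i) f (x + u *: basis i)) 0 t t0 (fun u _ => D u).
  apply: derivable_within_continuous => u _; exact: (@ex_derive _ _ _ _ _ _ _ (D u)).
by rewrite in_itv/= => /andP[u0 ut]; rewrite scale0r addr0 subr0 => ->; exists u; 
  rewrite ?(ltW u0) ?(ltW ut)// mulrC.
Qed.

Lemma partial_fdiff t i j f : (forall y, derivable f y (basis j)) ->
  partial j (fdiff t i f) = fdiff t i (partial j f).
Proof.
move=> df; apply/funext => x.
have D : is_derive x (basis j) (fdiff t i f) (fdiff t i (partial j f) x).
  apply: is_derive_line; rewrite /fdiff.
  have D1 := @is_derive_along f (x + t *: basis i) j 0.
  have D2 := @is_derive_along f x j 0.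
  have := is_deriveB (D1 (df _)) (D2 (df _)); rewrite !scale0r !addr0.
  congr is_derive; apply/funext => u /=.
  by rewrite !fctE addrAC.
exact: derive_val.
Qed.

Lemma partials_fdiff k t i s f : derivable_upto k f -> (size s <= k)%N ->
  partials s (fdiff t i f) = fdiff t i (partials s f).
Proof.
move=> df; elim: s => //= j s IH sk; rewrite IH 1?ltnW//.
by apply: partial_fdiff => y; exact: df.
Qed.

Lemma derivable_upto_fdiff k t i f : derivable_upto k f -> derivable_upto k (fdiff t i f).
Proof.
move=> df s j x sk; rewrite (partials_fdiff _ _ df) 1?ltnW//.
have D1 := @is_derive_along (partials s f) (x + t *: basis i) j 0 (df _ _ _ sk).
have D2 := @is_derive_along (partials s f) x j 0 (df _ _ _ sk).
apply: (@ex_derive _ _ _ _ _ _ _ (is_derive_line _)).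
have := is_deriveB D1 D2; rewrite !scale0r !addr0.
congr is_derive; apply/funext => u /=.
by rewrite !fctE addrAC.
Qed.

Lemma le_coord_norm x i : `|x ord0 i| <= `|x|.
Proof.
rewrite [`|x|]mx_normrE.
exact: (le_bigmax _ (fun ij : 'I_1 * 'I_n => `|x ij.1 ij.2|) (ord0, i)).
Qed.

Lemma norm_le_coord x c : 0 <= c -> (forall i, `|x ord0 i| <= c) -> `|x| <= c.
Proof.
move=> c0 xc; rewrite [`|x|]mx_normrE; apply: bigmax_le => // -[j i] _ /=.
by rewrite (ord1 j).
Qed.

Lemma norm_scale_basis t i : `|t *: basis i| <= `|t|.
Proof.
apply: norm_le_coord => // j; rewrite !mxE eqxx/=.
by case: eqP => _; rewrite ?mulr1// mulr0 normr0.
Qed.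

(** The induction hypothesis for [fdiff t i f] yields a difference of [partials s f], to which the
    one-variable mean value theorem applies. Each step moves the point by at most [t]. *)
Lemma fdiffs_mvt k t s f x : derivable_upto k f -> (size s <= k)%N -> 0 < t ->
  exists2 y, `|y - x| <= t *+ size s & fdiffs t s f x = t ^+ size s * partials s f y.
Proof.
move=> df sk t0; elim: s f df sk => [|i s IH] f df sk.
  by exists x; rewrite ?subrr ?normr0 ?mulr0n// expr0 mul1r.
rewrite /= fdiffsC.
have [y yx ->] := IH _ (@derivable_upto_fdiff k t i f df) (ltnW sk).
rewrite (partials_fdiff _ _ df (ltnW sk)) /fdiff.
have [u /andP[u0 ut] ->] := mvt_basis y t0 (fun z => df s i z sk).
exists (y + u *: basis i); last by rewrite mulrA -exprSr.
rewrite addrAC mulrSr (le_trans (ler_normD _ _))// lerD//.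
by rewrite (le_trans (norm_scale_basis _ _))// ger0_norm.
Qed.

(* The iterated difference does not depend on the order of the steps, and is
   close to each of the two derivatives. *)
Lemma partials_perm k s s' f : cont_diff k f -> (size s <= k)%N -> perm_eq s s' ->
  partials s f = partials s' f.
Proof.
move=> [df cf] sk ss'; have s'k : (size s' <= k)%N by rewrite -(perm_size ss').
apply/funext => x; apply/eqP; rewrite -subr_eq0 -normr_le0.
apply/ler_addgt0Pl => e e0; rewrite addr0.
have e2 : 0 < e / 2 by rewrite divr_gt0.
have /cvgrPdist_lt/(_ _ e2)/nbhs_normP[d d0 H] := cf s sk x.
have /cvgrPdist_lt/(_ _ e2)/nbhs_normP[d' d0' H'] := cf s' s'k x.
pose m := Num.min d d'; have m0 : 0 < m by rewrite lt_min; apply/andP.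
pose t := m / (size s).+1%:R; have t0 : 0 < t by rewrite divr_gt0.
have tm : t *+ size s < m.
  rewrite -mulr_natr /t -mulrA -{2}[m]mulr1 ltr_pM2l// mulrC ltr_pdivrMr// mul1r.
  by rewrite ltr_nat.
have [y yx E] := fdiffs_mvt x df sk t0.
have [y' yx' E'] := fdiffs_mvt x df s'k t0.
have := E'; rewrite -(fdiffs_perm _ _ ss') E -(perm_size ss').
move=> /(mulfI (lt0r_neq0 (exprn_gt0 _ t0))) yy'.
have h1 : `|partials s f x - partials s f y| < e / 2.
  apply: H; rewrite /= distrC (le_lt_trans yx)// (lt_le_trans tm)//.
  by rewrite /m ge_min lexx.
have h2 : `|partials s' f x - partials s' f y'| < e / 2.
  apply: H'; rewrite /= distrC (le_lt_trans yx')// -(perm_size ss') (lt_le_trans tm)//.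
  by rewrite /m ge_min lexx orbT.
rewrite [e]splitr -(subrKA (partials s f y)) (le_trans (ler_normD _ _))// lerD ?ltW//.
by rewrite yy' distrC.
Qed.

Lemma fdiffs_bound t s f M : (forall x, `|f x| <= M) ->
  forall x, `|fdiffs t s f x| <= 2 ^+ size s * M.
Proof.
move=> fM; elim: s => [|i s IH] x /=; first by rewrite expr0 mul1r.
rewrite /fdiff (le_trans (ler_normB _ _))// exprS -mulrA mulr2n mulrDl !mul1r.
by rewrite lerD.
Qed.

(* A unit-step difference of f is at once a nearby value of the derivative and
   at most 2 ^ (size s) * M. *)
Lemma partials_bounded k s f M C : derivable_upto k f -> (size s <= k)%N ->
  (forall x, `|f x| <= M) ->
  (forall x y, `|x - y| <= (size s)%:R -> `|partials s f x - partials s f y| <= C) ->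
  forall x, `|partials s f x| <= C + 2 ^+ size s * M.
Proof.
move=> df sk fM osc x; have [y yx] := fdiffs_mvt x df sk ltr01.
rewrite expr1n mul1r => E.
rewrite -[partials s f x](subrK (partials s f y)) (le_trans (ler_normD _ _))//.
apply: lerD; first by apply: osc; rewrite distrC.
by rewrite -E; apply: fdiffs_bound.
Qed.

(** Moves one coordinate at a time, each move by the mean value theorem. *)
Lemma partial_lip_sum f C (r : seq 'I_n) (c : 'I_n -> R) x :
  (forall i y, derivable f y (basis i)) -> (forall i y, `|'D_(basis i) f y| <= C) ->
  `|f (x + \sum_(i <- r) c i *: basis i) - f x| <= C * \sum_(i <- r) `|c i|.
Proof.
move=> df fC; elim: r x => [|i r IH] x; first by rewrite !big_nil addr0 subrr normr0 mulr0.
have step t y : `|f (y + t *: basis i) - f y| <= C * `|t|.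
  have [t0|t0|<-] := ltgtP 0 t; last by rewrite scale0r addr0 subrr !normr0 mulr0.
    have [u _ ->] := mvt_basis y t0 (df i).
    by rewrite normrM mulrC ler_wpM2r.
  (* For a negative step the mean value theorem is applied from the other endpoint. *)
  have Nt0 : 0 < - t by rewrite oppr_gt0.
  have := mvt_basis (y + t *: basis i) Nt0 (df i).
  rewrite -addrA -scalerDl subrr scale0r addr0 => -[u _ E].
  by rewrite distrC E normrM normrN mulrC ler_wpM2r.
rewrite !big_cons addrA mulrDr -(subrKA (f (x + c i *: basis i))).
by rewrite (le_trans (ler_normD _ _))// [leRHS]addrC lerD.
Qed.

Lemma partial_lip f C x y :
  (forall i z, derivable f z (basis i)) -> (forall i z, `|'D_(basis i) f z| <= C) ->
  `|f x - f y| <= C * n%:R * `|x - y|.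
Proof.
move=> df fC.
have E : x = y + \sum_(i <- enum 'I_n) (x - y) ord0 i *: basis i.
  by rewrite big_enum /= -[\sum_(i < n) _]row_sum_delta addrC subrK.
rewrite {1}E; apply: (le_trans (partial_lip_sum _ _ _ df fC)).
rewrite big_enum/= mulr_sumr -mulrA mulr_natl mulrnAr -[X in _ *+ X]card_ord -sumr_const.
apply: ler_sum => i _; rewrite ler_wpM2l ?le_coord_norm//.
exact: le_trans (fC i x).
Qed.

(** * Comparison of norms, Hölder bounds for derivatives, and second differences of half-regular
    functions *)

Lemma enorm_le x : enorm x <= n%:R * `|x|.
Proof.
rewrite /enorm -[leRHS]ger0_norm ?mulr_ge0// -sqrtr_sqr ler_wsqrtr//.
apply: (@le_trans _ _ (\sum_(i < n) `|x| ^+ 2)).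
  by apply: ler_sum => i _; rewrite -[x _ _ ^+ 2]real_normK ?num_real// lerXn2r ?nnegrE ?le_coord_norm.
rewrite sumr_const card_ord -[leLHS]mulr_natl exprMn ler_wpM2r ?sqr_ge0//.
by rewrite -natrX ler_nat; nia.
Qed.

Lemma le_coord_enorm x i : `|x ord0 i| <= enorm x.
Proof.
rewrite /enorm -sqrtr_sqr ler_wsqrtr// (bigD1 i)//= lerDl.
by apply: sumr_ge0 => j _; rewrite sqr_ge0.
Qed.

Lemma enorm_ge0 x : 0 <= enorm x.
Proof. exact: sqrtr_ge0. Qed.

(** [holder_space] controls derivatives taken in the sorted order of a multi-index; symmetry carries
    its bound over to any sequence [s]. *)
Lemma mpartial_count k s f : cont_diff k f -> (size s <= k)%N ->
  mpartial [ffun i => count_mem i s] f = partials s f.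
Proof.
move=> cf sk; have p : perm_eq s (flatten [seq nseq (count_mem i s) i | i <- enum 'I_n]).
  rewrite /perm_eq; apply/allP => j _ /=; apply/eqP.
  rewrite count_flatten -map_comp sumnE big_map big_enum/= (bigD1 j)//= count_nseq/= eqxx mul1n.
  by rewrite big1 ?addn0// => m /negPf mj; rewrite count_nseq/= mj.
rewrite (partials_perm cf sk p) /mpartial; congr (partials (flatten _) f).
by apply: eq_map => m; rewrite ffunE.
Qed.

Lemma holder_partials k b f s : 0 <= b -> holder_space k b f -> size s = k ->
  exists2 M, 0 <= M &
    forall x y, `|partials s f x - partials s f y| <= M * `|x - y| `^ b.
Proof.
move=> b0 [cf hf] sk; have sk' : (size s <= k)%N by rewrite sk.
have [|M HM] := hf [ffun m => count_mem m s].
  rewrite /mdeg -sk -sum1_size (eq_bigr (fun m => count_mem m s)) => [|m _]; last by rewrite ffunE.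
  under eq_bigr do rewrite -sum1_count.
  rewrite (exchange_big_dep predT)//=; apply: eq_bigr => m _.
  by rewrite (big_pred1 m).
rewrite (mpartial_count cf sk') in HM.
exists (`|M| * n%:R `^ b) => [|x y]; first by rewrite mulr_ge0 ?powR_ge0.
have [->|xy] := eqVneq x y; first by rewrite !subrr normr0 !mulr_ge0 ?powR_ge0.
have xy0 : 0 < `|x - y| by rewrite normr_gt0 subr_eq0.
have e0 : 0 < enorm (x - y).
  rewrite lt_neqAle enorm_ge0 andbT eq_sym; apply: contraTneq xy0 => e0.
  by rewrite -leNgt; apply: norm_le_coord => // m; rewrite -e0 le_coord_enorm.
have := HM x y; rewrite ler_pdivrMr ?powR_gt0// => /(_ (elimN eqP xy)) H.
apply: (le_trans H); rewrite -mulrA -powRM//.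
apply: (@le_trans _ _ (`|M| * enorm (x - y) `^ b)).
  by rewrite ler_wpM2r ?powR_ge0 ?ler_norm.
by rewrite ler_wpM2l// ge0_ler_powR ?nnegrE ?mulr_ge0 ?enorm_le ?enorm_ge0.
Qed.

(** Downward induction on the order. At order [k] the Hölder condition bounds the oscillation over
    bounded distances; below it, bounds one order higher make the derivative Lipschitz.
    [partials_bounded] then gives a bound on the derivative itself. *)
Lemma bounded_partials k b f M s : 0 <= b -> holder_space k b f ->
  (forall x, `|f x| <= M) -> (size s <= k)%N ->
  exists C, forall x, `|partials s f x| <= C.
Proof.
move=> b0 [[df cf] hf] fM; move Ed : (k - size s)%N => d sk.
elim: d s Ed sk => [|d IH] s Ed sk.
  have {Ed}sk' : size s = k by apply/eqP; rewrite eqn_leq sk -subn_eq0 Ed.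
  have [C C0 H] := holder_partials b0 (conj (conj df cf) hf) sk'.
  exists (C * (size s)%:R `^ b + 2 ^+ size s * M).
  apply: (partials_bounded df sk fM) => x y xy.
  by apply: (le_trans (H x y)); rewrite ler_wpM2l// ge0_ler_powR ?nnegrE.
have sk' : (size s < k)%N by rewrite -subn_gt0 Ed.
have /choice[C HC] i : exists C, forall x, `|partials (i :: s) f x| <= C.
  by apply: IH => //=; rewrite subnS Ed.
pose D := \sum_i `|C i|.
have HD i x : `|'D_(basis i) (partials s f) x| <= D.
  apply: (le_trans (HC i x)); rewrite /D (bigD1 i)//= (le_trans (ler_norm _))// lerDl.
  exact: sumr_ge0.
have D0 : 0 <= D by apply: sumr_ge0.
exists (D * n%:R * (size s)%:R + 2 ^+ size s * M).
apply: (partials_bounded df sk fM) => x y xy.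
apply: (le_trans (partial_lip x y (fun i z => df s i z sk') HD)).
by rewrite ler_wpM2l ?mulr_ge0.
Qed.

(** Both differences are [t ^+ 2] times a second derivative, at points at distance at most 6 t. A
    Hölder exponent c of that derivative gives t^(4 + 2 c) after squaring, to be compared with
    min(k, 5) + a. *)
Lemma half_regular_diff k a f M i j : 0 < a <= 1 -> (4 <= k)%N ->
  half_regular k a f -> (forall x, `|f x| <= M) ->
  exists C, forall z h t, 0 < t <= 1 -> `|h| <= 2 * t ->
    (fdiffs t [:: i; j] f (z + h) - fdiffs t [:: i; j] f z) ^+ 2
      <= C * t `^ ((minn k 5)%:R + a).
Proof.
move=> /andP[a0 a1] k4 hf fM.
(* Both parities at once. For k = 4 and k = 5 the exponent 4 + 2 b equals k + a; from k = 6 on there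
   are third derivatives. *)
have [l [b [/andP[b0 b1] l2 hl cmp]]] : exists l b, [/\ 0 < b <= 1, (2 <= l)%N,
    holder_space l b f & (3 <= l)%N \/ (minn k 5)%:R + a <= 4 + 2 * b].
  move: hf; rewrite /half_regular; case: ifP => ok hf.
    exists ((k - 1) %/ 2)%N, ((1 + a) / 2); split=> //; [lra|lia|].
    have [k5|k6] := leqP k 5; [right|left; lia].
    by rewrite (_ : k = 5)%N; [lra | lia].
  exists (k %/ 2)%N, (a / 2); split=> //; [lra|lia|].
  have [k4'|k6] := leqP k 5; [right|left; lia].
  by rewrite (_ : k = 4)%N; [lra | lia].
pose s := [:: i; j].
(* If third derivatives exist, their boundedness makes the second ones Lipschitz: then c = 1 and 5 +
   a <= 6. *)
have [B [c [B0 c0 cmp' H]]] : exists B c, [/\ 0 <= B, 0 <= c,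
    (minn k 5)%:R + a <= 4 + 2 * c &
    forall x y, `|partials s f x - partials s f y| <= B * `|x - y| `^ c].
  have [l2'|l3] := leqP l 2; last first.
    have /choice[C HC] m : exists C, forall x, `|partials (m :: s) f x| <= C.
      by apply: (bounded_partials (ltW b0) hl fM).
    have df := hl.1.1.
    pose D := \sum_m `|C m|.
    have HD m x : `|'D_(basis m) (partials s f) x| <= D.
      apply: (le_trans (HC m x)); rewrite /D (bigD1 m)//= (le_trans (ler_norm _))// lerDl.
      exact: sumr_ge0.
    have D0 : 0 <= D by apply: sumr_ge0.
    exists (D * n%:R), 1; split => //; first by rewrite mulr_ge0.
      have : (minn k 5)%:R <= 5 :> R by rewrite ler_nat geq_minr.
      lra.
    by move=> x y; rewrite powRr1//; apply: partial_lip => // m z; apply: df.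
  have E : size s = l by rewrite /=; lia.
  have [B B0 H] := holder_partials (ltW b0) hl E.
  exists B, b; split => //; first exact: ltW.
  by case: cmp => //; lia.
exists ((B * 6 `^ c) ^+ 2) => z h t /andP[t0 t1] ht.
have [y yz ->] := fdiffs_mvt (s := s) (z + h) hl.1.1 l2 t0.
have [y' yz' ->] := fdiffs_mvt (s := s) z hl.1.1 l2 t0.
(* Three distances of at most 2 t: from y to z + h, the shift h, and from z to y'. *)
have yy : `|y - y'| <= 6 * t.
  rewrite (_ : y - y' = (y - (z + h)) + h + (z - y')); last first.
    by rewrite opprD [y + (_ - _)]addrA subrK addrA subrK.
  apply: (le_trans (ler_normD _ _)); rewrite [`|z - _|]distrC.
  have := ler_normD (y - (z + h)) h; rewrite /= in yz yz' *.
  by rewrite !mulr2n in yz yz'; lra.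
rewrite -mulrBr exprMn -exprM /= -[_ ^+ 2 in X in _ * X]real_normK ?num_real//.
apply: (@le_trans _ _ (t ^+ 4 * (B * (6 * t) `^ c) ^+ 2)).
  rewrite ler_wpM2l ?exprn_ge0 ?(ltW t0)// ler_sqr ?nnegrE ?mulr_ge0 ?powR_ge0//.
  apply: (le_trans (H _ _)); rewrite ler_wpM2l// ge0_ler_powR ?nnegrE//.
  by rewrite mulr_ge0// ltW.
rewrite powRM ?(ltW t0)// [B * (_ * _)]mulrA; set D := B * 6 `^ c.
rewrite exprMn mulrCA; apply: ler_wpM2l; first exact: sqr_ge0.
rewrite -powR_mulrn ?(ltW t0)// -powR_mulrn ?powR_ge0// -powRrM -powRD; last first.
  by rewrite (gt_eqF t0) implybT.
by rewrite ger_powR ?t0// mulrC.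
Qed.

End Differences.

(** * An algebra of functions with bounded derivatives of all orders *)

Section Tame.
Variables (R : realType) (n : nat).
Implicit Types (f g : 'rV[R]_n -> R) (x y : 'rV[R]_n).

Lemma lipschitz_line (p p' : R -> R) C :
  (forall u : R, is_derive u (1 : R) p (p' u)) -> (forall u, `|p' u| <= C) ->
  forall u v, `|p u - p v| <= C * `|u - v|.
Proof.
move=> dp pC u v; wlog uv : u v / v < u.
  move=> H; have [uv|uv|->] := ltgtP v u; first exact: H.
    by rewrite distrC [`|u - v|]distrC; apply: H.
  by rewrite !subrr normr0 mulr0.
have [|c _ ->] := @MVT _ p p' v u uv (fun c _ => dp c).
  by apply: derivable_within_continuous => c _; exact: (@ex_derive _ _ _ _ _ _ _ (dp c)).
by rewrite normrM ler_wpM2r.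
Qed.

Lemma is_derive_coord (p p' : R -> R) i j x :
  (forall u : R, is_derive u (1 : R) p (p' u)) ->
  is_derive x (basis R i) (fun x => p (x ord0 j)) ((i == j)%:R * p' (x ord0 j)).
Proof.
move=> dp; apply: is_derive_line.
have [->|ij] := eqVneq i j; last first.
  have -> : (fun t : R => p ((x + t *: basis R i) ord0 j)) = cst (p (x ord0 j)).
    by apply/funext => t; rewrite !mxE eqxx/= eq_sym (negPf ij) mulr0 addr0.
  rewrite mul0r; exact: is_derive_cst.
have E : (fun h : R => h^-1 *: (((fun t => p ((x + t *: basis R j) ord0 j)) \o shift 0) (h *: 1)
     - p ((x + 0 *: basis R j) ord0 j)))
     = (fun h => h^-1 *: ((p \o shift (x ord0 j)) (h *: 1) - p (x ord0 j))).
  apply/funext => h /=.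
  by rewrite !mxE !eqxx /= !mulr1 !addr0 addrC.
rewrite [true%:R]mulr1n mul1r.
by case: (dp (x ord0 j)) => d1 d2; split; move: d1 d2; rewrite /derivable /derive E.
Qed.

Lemma oneDsqr_gt0 (u : R) : 0 < 1 + u ^+ 2.
Proof. by rewrite ltr_wpDr ?sqr_ge0. Qed.

Lemma is_derive_bump (u : R) : is_derive u (1 : R) (fun u : R => (1 + u ^+ 2)^-1)
  (- 2 * ((1 + u ^+ 2)^-1 * (u * (1 + u ^+ 2)^-1))).
Proof.
have u0 := lt0r_neq0 (oneDsqr_gt0 u).
have D : is_derive u (1 : R) (fun u : R => 1 + u ^+ 2) (0 + 2 * u).
  apply: is_deriveD; apply: is_derive_eq (is_deriveX 2 (is_derive_id u (1 : R))) _.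
  by rewrite /GRing.scale/= mulr1.
apply: (is_derive_eq (is_deriveV (f := fun u : R => 1 + u ^+ 2) u0 D)).
rewrite /GRing.scale/=; field.
by [].
Qed.

Lemma is_derive_odd_bump (u : R) : is_derive u (1 : R) (fun u : R => u * (1 + u ^+ 2)^-1)
  ((1 + u ^+ 2)^-1 + - 2 * ((u * (1 + u ^+ 2)^-1) * (u * (1 + u ^+ 2)^-1))).
Proof.
apply: (is_derive_eq (is_deriveM (is_derive_id u (1 : R)) (is_derive_bump u))).
rewrite /GRing.scale/=; ring.
Qed.

Lemma bump_le1 (u : R) : `|(1 + u ^+ 2)^-1| <= 1.
Proof.
rewrite ger0_norm ?invr_ge0 ?(ltW (oneDsqr_gt0 u))// invf_le1 ?oneDsqr_gt0//.
by rewrite lerDl sqr_ge0.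
Qed.

Lemma odd_bump_le1 (u : R) : `|u * (1 + u ^+ 2)^-1| <= 1.
Proof.
rewrite normrM [`|_^-1|]ger0_norm ?invr_ge0 ?(ltW (oneDsqr_gt0 u))//.
rewrite ler_pdivrMr ?oneDsqr_gt0// mul1r ler_norml.
have := sqr_ge0 (u - 1); have := sqr_ge0 (u + 1).
by have [] := ger0P u => ? ? ?; apply/andP; split; nra.
Qed.

(** All generators are bounded. 1/(1 + u^2) is paired with u/(1 + u^2) because the derivative of
    either is a polynomial in the two, so the class is closed under differentiation. *)
Inductive tame : ('rV[R]_n -> R) -> Prop :=
| tame_cst c : tame (fun=> c)
| tame_sin i : tame (fun x => sin (x ord0 i))
| tame_cos i : tame (fun x => cos (x ord0 i))
| tame_bump i : tame (fun x => (1 + x ord0 i ^+ 2)^-1)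
| tame_odd_bump i : tame (fun x => x ord0 i * (1 + x ord0 i ^+ 2)^-1)
| tame_add f g : tame f -> tame g -> tame (fun x => f x + g x)
| tame_mul f g : tame f -> tame g -> tame (fun x => f x * g x).

Lemma tame_opp f : tame f -> tame (fun x => - f x).
Proof.
by move=> tf; under eq_fun do rewrite -mulN1r; apply: tame_mul; first exact: tame_cst.
Qed.

Lemma tame_exp f m : tame f -> tame (fun x => f x ^+ m).
Proof.
move=> tf; elim: m => [|m IH]; first exact: (tame_cst 1).
by under eq_fun do rewrite exprS; apply: tame_mul.
Qed.

Lemma tame_derive f i : tame f ->
  exists2 f', tame f' & forall x, is_derive x (basis R i) f (f' x).
Proof.
elim=> {f}.
- move=> c; exists (fun=> 0); first exact: tame_cst.
  by move=> x; exact: is_derive_cst.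
- move=> j; exists (fun x => (i == j)%:R * cos (x ord0 j)).
    by apply: tame_mul; [exact: tame_cst|exact: tame_cos].
  by move=> x; apply: is_derive_coord => u; exact: is_derive_sin.
- move=> j; exists (fun x => (i == j)%:R * - sin (x ord0 j)).
    by apply: tame_mul; [exact: tame_cst|apply: tame_opp; exact: tame_sin].
  by move=> x; apply: (@is_derive_coord _ (fun u => - sin u)) => u; exact: is_derive_cos.
- move=> j; eexists; last first.
    by move=> x; apply: (is_derive_coord _ _ _ is_derive_bump).
  apply: tame_mul; first exact: tame_cst.
  apply: tame_mul; first exact: tame_cst.
  by apply: tame_mul; [exact: tame_bump|exact: tame_odd_bump].
- move=> j; eexists; last first.
    by move=> x; apply: (is_derive_coord _ _ _ is_derive_odd_bump).
  apply: tame_mul; first exact: tame_cst.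
  apply: tame_add; first exact: tame_bump.
  apply: tame_mul; first exact: tame_cst.
  by apply: tame_mul; exact: tame_odd_bump.
- move=> f g _ [f' tf' df] _ [g' tg' dg]; exists (fun x => f' x + g' x).
    exact: tame_add.
  by move=> x; exact: is_deriveD.
- move=> f g tf [f' tf' df] tg [g' tg' dg].
  exists (fun x => f x * g' x + g x * f' x).
    by apply: tame_add; exact: tame_mul.
  by move=> x; exact: is_deriveM.
Qed.

Lemma tame_partials f s : tame f -> tame (partials s f).
Proof.
move=> tf; elim: s => //= i s IH; have [f' tf' df] := tame_derive i IH.
by rewrite (_ : partial i _ = f')//; apply/funext => x; exact: (@derive_val _ _ _ _ _ _ _ (df x)).
Qed.

Lemma tame_bounded f : tame f -> exists M, forall x, `|f x| <= M.
Proof.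
elim=> {f}.
- by move=> c; exists `|c|.
- by move=> i; exists 1 => x; rewrite ler_norml sin_geN1 sin_le1.
- by move=> i; exists 1 => x; rewrite ler_norml cos_geN1 cos_le1.
- by move=> i; exists 1 => x; exact: bump_le1.
- by move=> i; exists 1 => x; exact: odd_bump_le1.
- move=> f g _ [M fM] _ [M' gM]; exists (M + M') => x.
  by rewrite (le_trans (ler_normD _ _))// lerD.
- move=> f g _ [M fM] _ [M' gM]; exists (M * M') => x.
  by rewrite normrM ler_pM.
Qed.

Lemma tame_lipschitz f : tame f ->
  exists2 L, 0 <= L & forall x y, `|f x - f y| <= L * enorm (x - y).
Proof.
have coord (p p' : R -> R) C i : (forall u : R, is_derive u (1 : R) p (p' u)) ->
    (forall u, `|p' u| <= C) ->
    exists2 L, 0 <= L & forall x y, `|p (x ord0 i) - p (y ord0 i)| <= L * enorm (x - y).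
  move=> dp pC; have C0 : 0 <= C by apply: le_trans (pC 0).
  exists C => // x y; apply: (le_trans (lipschitz_line dp pC _ _)).
  by have := le_coord_enorm (x - y) i; rewrite !mxE; apply: ler_wpM2l.
elim=> {f}.
- by move=> c; exists 0 => // x y; rewrite subrr normr0 mul0r.
- move=> i; apply: (coord _ _ 1 i (@is_derive_sin R)) => u.
  by rewrite ler_norml cos_geN1 cos_le1.
- move=> i; apply: (coord _ _ 1 i (@is_derive_cos R)) => u.
  by rewrite normrN ler_norml sin_geN1 sin_le1.
- move=> i; apply: (coord (fun u => (1 + u ^+ 2)^-1) _ (2 * (1 * 1)) i is_derive_bump) => u.
  by rewrite normrM normrN normr_nat ler_wpM2l// normrM ler_pM ?bump_le1 ?odd_bump_le1.
- move=> i; apply: (coord (fun u => u * (1 + u ^+ 2)^-1) _ (1 + 2 * (1 * 1)) i is_derive_odd_bump) => u.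
  rewrite (le_trans (ler_normD _ _))// lerD ?bump_le1//.
  by rewrite normrM normrN normr_nat ler_wpM2l// normrM ler_pM ?odd_bump_le1.
- move=> f g _ [L L0 fL] _ [L' L0' gL]; exists (L + L'); first exact: addr_ge0.
  move=> x y; rewrite opprD addrACA (le_trans (ler_normD _ _))// mulrDl.
  by rewrite lerD.
- move=> f g tf [L L0 fL] tg [L' L0' gL].
  have [M fM] := tame_bounded tf; have [M' gM] := tame_bounded tg.
  have M0 : 0 <= M by apply: le_trans (fM 0).
  have M0' : 0 <= M' by apply: le_trans (gM 0).
  exists (M * L' + M' * L); first by rewrite addr_ge0// mulr_ge0.
  move=> x y.
  have -> : f x * g x - f y * g y = f x * (g x - g y) + g y * (f x - f y) by ring.
  rewrite (le_trans (ler_normD _ _))// mulrDl -!mulrA !normrM.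
  by rewrite lerD// ler_pM.
Qed.

(** Up to distance r = 1 the Lipschitz bound suffices, as r <= r^a there; beyond, [2 * M] does, as
    r^a >= 1. *)
Lemma tame_holder_bounded f a : 0 < a <= 1 -> tame f -> holder_bounded a f.
Proof.
move=> /andP[a0 a1] tf; have [M fM] := tame_bounded tf.
have [L L0 fL] := tame_lipschitz tf.
have M0 : 0 <= M by apply: le_trans (fM 0).
exists (2 * M + L) => x y _.
(* 0^a = 0 because a > 0, and the inverse of 0 is 0 by convention, so the quotient vanishes. *)
have [->|e_neq0] := eqVneq (enorm (x - y)) 0.
  by rewrite powR0 ?gt_eqF// invr0 mulr0 addr_ge0// mulr_ge0.
have e0 : 0 < enorm (x - y) by rewrite lt_neqAle eq_sym e_neq0 enorm_ge0.
rewrite ler_pdivrMr ?powR_gt0//.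
have [e1|e1] := leP (enorm (x - y)) 1.
  apply: (le_trans (fL x y)).
  apply: (@le_trans _ _ (L * enorm (x - y) `^ a)).
    by rewrite ler_wpM2l// ger1_powR// e0 e1.
  by rewrite ler_wpM2r ?powR_ge0// lerDr mulr_ge0.
apply: (@le_trans _ _ (2 * M)).
  by rewrite mulr2n mulrDl !mul1r (le_trans (ler_normB _ _))// lerD.
rewrite -[leLHS]mulr1; apply: ler_pM; rewrite ?mulr_ge0// ?lerDl//.
by rewrite -(powRr0 (enorm (x - y))) ler_powR// ltW.
Qed.

Lemma tame_holder_space f k a : 0 < a <= 1 -> tame f -> holder_space k a f.
Proof.
move=> a01 tf; split; [split|].
- move=> s i x _; have [f' _ df] := tame_derive i (tame_partials s tf).
  exact: (@ex_derive _ _ _ _ _ _ _ (df x)).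
- move=> s _ x; have [L L0 fL] := tame_lipschitz (tame_partials s tf).
  apply/(@cvgrPdist_lt _ _ _ (nbhs x)) => e e0.
  (* The summand 1 keeps [K] positive when [L] is 0. *)
  pose K := L * n%:R + 1; have K0 : 0 < K by rewrite ltr_wpDl ?mulr_ge0.
  have := nbhsx_ballx x _ (divr_gt0 e0 K0); rewrite -ball_normE.
  apply: filterS => y /=; rewrite ltr_pdivlMr// mulrC => xy.
  apply: le_lt_trans xy; apply: (le_trans (fL x y)).
  apply: (@le_trans _ _ (L * (n%:R * `|x - y|))); first by rewrite ler_wpM2l ?enorm_le.
  by rewrite mulrA ler_wpM2r// lerDl.
- by move=> b _; apply: tame_holder_bounded => //; exact: tame_partials.
Qed.

End Tame.

(** * Non-negativity of the two polynomials, and the Cauchy-Schwarz inequality *)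

Section Forms.
Variable R : realType.
Implicit Types u v z w : R.

(* The quintic part is a multiple of the tangent at (-w, -w) and of the squares of
   the lines joining the vertices (w, 0), (0, w) and (-w, 0), (0, -w), plus w^5. *)
Definition hexagon_tail u v w : R :=
  ((u + v) ^+ 2 - w ^+ 2) ^+ 2 * (u + v + 2 * w) + w ^+ 5.

Definition hexagon_poly u v w : R :=
  1024 * (u ^+ 2 - u * v + v ^+ 2 - w ^+ 2) ^+ 2 + hexagon_tail u v w.

(** The tail can be negative only beyond the tangent u + v = -2 w. There the square must dominate,
    and the factor 1024 is large enough for that. *)
Lemma hexagon_poly_ge0 u v w : `|u| <= 1 -> `|v| <= 1 -> 0 < w <= 1 ->
  0 <= hexagon_poly u v w.
Proof.
rewrite !ler_norml => /andP[u1 _] /andP[v1 _] /andP[w0 w1].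
rewrite /hexagon_poly /hexagon_tail.
set q := u ^+ 2 - u * v + v ^+ 2 - w ^+ 2.
have w5 : 0 <= w ^+ 5 by rewrite exprn_ge0 ?ltW.
have [s0|s0] := leP 0 (u + v + 2 * w).
  by rewrite !addr_ge0// mulr_ge0// sqr_ge0.
pose r := - (u + v); pose e := r - 2 * w.
have e0 : 0 < e by rewrite /e /r; lra.
have r0 : 0 < r by rewrite /r; lra.
have r2 : r <= 2 by rewrite /r; lra.
(* u^2 - u v + v^2 is (u + v)^2 / 4 plus 3 (u - v)^2 / 4, so q is at least (r^2 - 4 w^2) / 4. *)
have qe : e * (r + 2 * w) / 4 <= q.
  have : q - e * (r + 2 * w) / 4 = 3 / 4 * (u - v) ^+ 2 by rewrite /q /e /r; field.
  have := sqr_ge0 (u - v); lra.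
have er0 : 0 <= e * (r + 2 * w) / 4.
  by apply: divr_ge0 => //; apply: mulr_ge0; lra.
have -> : ((u + v) ^+ 2 - w ^+ 2) ^+ 2 * (u + v + 2 * w) = - ((r ^+ 2 - w ^+ 2) ^+ 2 * e).
  by rewrite /e /r; ring.
have rw0 : 0 <= r ^+ 2 - w ^+ 2.
  by rewrite subr_ge0 lerXn2r ?nnegrE ?(ltW w0) ?(ltW r0)//; rewrite /e in e0; lra.
suff : (r ^+ 2 - w ^+ 2) ^+ 2 * e <= 1024 * q ^+ 2 + w ^+ 5 by lra.
(* Near the tangent q >= e w, and w^2 (32 e - w^2)^2 >= 0 together with w^6 <= w^5 gives the claim.
   Far from it e >= r / 3, and r <= 2 makes 64 e at least r^2: the square alone suffices. *)
have [r3|r3] := leP r (3 * w).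
  have h1 : r ^+ 2 - w ^+ 2 <= 8 * w ^+ 2.
    have : r ^+ 2 <= (3 * w) ^+ 2 by rewrite lerXn2r ?nnegrE ?mulr_ge0 ?(ltW r0) ?(ltW w0).
    lra.
  have h2 : (r ^+ 2 - w ^+ 2) ^+ 2 <= (8 * w ^+ 2) ^+ 2.
    by rewrite lerXn2r// nnegrE; have := sqr_ge0 w; lra.
  have h3 : (r ^+ 2 - w ^+ 2) ^+ 2 * e <= (8 * w ^+ 2) ^+ 2 * e by rewrite ler_wpM2r ?(ltW e0).
  have ew : e * w <= q.
    by apply: le_trans qe; rewrite -mulrA ler_wpM2l ?(ltW e0)//; rewrite /e in e0; lra.
  have h4 : (e * w) ^+ 2 <= q ^+ 2.
    have ew0 : 0 <= e * w by rewrite mulr_ge0 ?(ltW e0) ?(ltW w0).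
    by rewrite lerXn2r// nnegrE// (le_trans ew0).
  have h5 : 0 <= w ^+ 2 * (32 * e - w ^+ 2) ^+ 2 by rewrite mulr_ge0 ?sqr_ge0.
  have h6 : w ^+ 6 <= w ^+ 5 by rewrite exprS ler_piMl.
  have : w ^+ 2 * (32 * e - w ^+ 2) ^+ 2 =
    1024 * (e * w) ^+ 2 - (8 * w ^+ 2) ^+ 2 * e + w ^+ 6 by ring.
  lra.
have er : e * r / 4 <= q.
  apply: le_trans qe; rewrite -!mulrA ler_wpM2l ?(ltW e0)//; lra.
have er0' : 0 <= e * r / 4 by rewrite divr_ge0 ?mulr_ge0 ?(ltW e0) ?(ltW r0).
have h4 : (e * r / 4) ^+ 2 <= q ^+ 2 by rewrite lerXn2r// nnegrE// (le_trans er0').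
have h2 : (r ^+ 2 - w ^+ 2) ^+ 2 <= (r ^+ 2) ^+ 2.
  by rewrite lerXn2r ?nnegrE ?sqr_ge0// gerBl sqr_ge0.
have h3 : (r ^+ 2 - w ^+ 2) ^+ 2 * e <= (r ^+ 2) ^+ 2 * e by rewrite ler_wpM2r ?(ltW e0).
have h1 : 0 <= (r ^+ 2 * e) * (64 * e - r ^+ 2).
  apply: mulr_ge0; first by rewrite mulr_ge0 ?sqr_ge0 ?(ltW e0).
  have : r / 3 <= e by rewrite /e; lra.
  nra.
have : (r ^+ 2 * e) * (64 * e - r ^+ 2) = 1024 * (e * r / 4) ^+ 2 - (r ^+ 2) ^+ 2 * e by field.
lra.
Qed.

(** The squares vanish at all vertices of the cube {0, w}^3, and the cubic term at all of them but
    (w, w, w). *)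
Definition cube_poly u v z w : R :=
  128 ^+ 2 * ((u * (u - w)) ^+ 2 + (v * (v - w)) ^+ 2 + (z * (z - w)) ^+ 2)
    + 60 * w * (u * v * z) + w ^+ 4.

(** With c, a, b the absolute values of the three quadratic factors, the cubic term is at least -60
    c (4 w^2 + a + b). Absorbing this takes w^4, 30 a^2, 30 b^2 and (120^2 + 60) c^2, and 128^2
    exceeds these coefficients. *)
Lemma cube_poly_ge0_neg u v z w : 0 < w -> u < 0 -> 0 <= cube_poly u v z w.
Proof.
move=> w0 u0.
(* Either |t| <= 2 w or |t| <= 2 |t - w|. *)
have sq t : t ^+ 2 <= 4 * w ^+ 2 + 2 * `|t * (t - w)|.
  have [t2|t2] := leP `|t| (2 * w).
    have : `|t| ^+ 2 <= (2 * w) ^+ 2 by rewrite lerXn2r// nnegrE// mulr_ge0// ltW.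
    rewrite real_normK ?num_real// exprMn; have := normr_ge0 (t * (t - w)); lra.
  have : `|t| <= 2 * `|t - w|.
    by have := ler_normD (t - w) w; rewrite subrK (gtr0_norm w0); lra.
  rewrite normrM -[t ^+ 2]real_normK ?num_real//; have := normr_ge0 t.
  have := sqr_ge0 w; nra.
pose c := u * (u - w); pose a := `|v * (v - w)|; pose b := `|z * (z - w)|.
have cw : - u * w <= c by rewrite /c; nra.
have c0 : 0 <= c by rewrite /c; nra.
have a0 : 0 <= a := normr_ge0 _.
have b0 : 0 <= b := normr_ge0 _.
have vz : `|v * z| <= 4 * w ^+ 2 + a + b.
  have := sq v; have := sq z; rewrite -/a -/b.
  rewrite normrM -[v ^+ 2]real_normK ?num_real// -[z ^+ 2]real_normK ?num_real//.
  have := sqr_ge0 (`|v| - `|z|); nra.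
have uw : 0 <= - u * w by rewrite mulr_ge0 ?ltW ?oppr_gt0.
have h : - u * w * `|v * z| <= c * (4 * w ^+ 2 + a + b) by apply: ler_pM.
have h' : - u * w * (v * z) <= - u * w * `|v * z| by rewrite ler_wpM2l ?ler_norm.
rewrite /cube_poly -/c -[(v * (v - w)) ^+ 2]real_normK ?num_real//.
rewrite -[(z * (z - w)) ^+ 2]real_normK ?num_real// -/a -/b.
have := sqr_ge0 (120 * c - w ^+ 2); have := sqr_ge0 (c - a); have := sqr_ge0 (c - b).
have := sqr_ge0 c; have := sqr_ge0 a; have := sqr_ge0 b.
nra.
Qed.

(** By symmetry a negative variable may be taken to be the first; if there is none, every term is
    non-negative. *)
Lemma cube_poly_ge0 u v z w : 0 < w -> 0 <= cube_poly u v z w.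
Proof.
move=> w0; have [u0|u0] := ltP u 0; first exact: cube_poly_ge0_neg.
have [v0|v0] := ltP v 0.
  rewrite (_ : cube_poly u v z w = cube_poly v u z w); last by rewrite /cube_poly; ring.
  exact: cube_poly_ge0_neg.
have [z0|z0] := ltP z 0.
  rewrite (_ : cube_poly u v z w = cube_poly z v u w); last by rewrite /cube_poly; ring.
  exact: cube_poly_ge0_neg.
have w4 : 0 <= w ^+ 4 by rewrite exprn_ge0 ?ltW.
rewrite /cube_poly !addr_ge0// mulr_ge0 ?addr_ge0 ?sqr_ge0//; first by rewrite mulr_ge0// ltW.
by rewrite !mulr_ge0.
Qed.

(** Inductive step of Cauchy-Schwarz: multiplied by [m], the gap is at least (m x - s)^2. *)
Lemma sqr_cons_le (m x s S : R) : 0 < m -> s ^+ 2 <= m * S ->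
  (x + s) ^+ 2 <= (m + 1) * (x ^+ 2 + S).
Proof.
move=> m0 sS; rewrite -(ler_pM2l m0).
have := sqr_ge0 (m * x - s); nra.
Qed.

End Forms.

Lemma sqr_sum_le (R : realType) (s : seq R) :
  (\sum_(x <- s) x) ^+ 2 <= (size s)%:R * \sum_(x <- s) x ^+ 2.
Proof.
elim: s => [|x s IH]; first by rewrite !big_nil expr0n mul0r.
(* [sqr_cons_le] requires a positive [m], so the one-element list is treated apart. *)
rewrite !big_cons -natr1; case: s IH => [|y s] IH.
  by rewrite !big_nil !addr0 add0r mul1r.
by apply: sqr_cons_le => //; rewrite ltr0n.
Qed.

(** * Inequalities satisfied by bounded sums of half-regular squares *)

Section SumsOfSquares.
Variables (R : realType) (n k : nat) (a : R) (f : 'rV[R]_n -> R).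
Hypotheses (a01 : 0 < a <= 1) (k4 : (4 <= k)%N).
Hypothesis f_bounded : exists M, forall x, `|f x| <= M.
Hypothesis f_sos : finite_sum_of_squares (half_regular k a) f.

(** Each [g l] is bounded because its square is at most [f], so [half_regular_diff] applies to it;
    the constants add up. *)
Lemma sos_fdiff i j : exists m (g : 'I_m -> 'rV[R]_n -> R) C,
  (forall x, f x = \sum_l g l x ^+ 2) /\
  forall z h t, 0 < t <= 1 -> `|h| <= 2 * t ->
    \sum_l (fdiffs t [:: i; j] (g l) (z + h) - fdiffs t [:: i; j] (g l) z) ^+ 2
      <= C * t `^ ((minn k 5)%:R + a).
Proof.
have [M fM] := f_bounded; have [m [g [hg fg]]] := f_sos.
(* M < (M + 1)^2, which avoids a square root. *)
have gM l x : `|g l x| <= M + 1.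
  have M0 : 0 <= M := le_trans (normr_ge0 _) (fM x).
  have : g l x ^+ 2 <= M.
    apply: le_trans (le_trans (ler_norm _) (fM x)).
    by rewrite fg (bigD1 l)//= lerDl sumr_ge0// => l' _; rewrite sqr_ge0.
  rewrite -[_ ^+ 2]real_normK ?num_real// => gM.
  have := normr_ge0 (g l x); nra.
have /choice[C HC] l := half_regular_diff i j a01 k4 (hg l) (gM l).
exists m, g, (\sum_l C l); split => // z h t t01 ht.
by rewrite mulr_suml; apply: ler_sum => l _; apply: HC.
Qed.

(** For each square separately, the values at z + h and at z + p + q cancel because h = p + q.
    Cauchy-Schwarz is then applied to five values and the error. *)
Lemma sos_hexagon i j : exists C, forall z t p q h, 0 < t <= 1 ->
  p = t *: basis R i -> q = t *: basis R j -> h = p + q ->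
  f (z + h + p + q) <=
    6 * (f (z + h + p) + f (z + h + q) + f (z + p) + f (z + q) + f z
         + C * t `^ ((minn k 5)%:R + a)).
Proof.
have [m [g [C [fg gC]]]] := sos_fdiff i j; exists C => z t p q h t01 Ep Eq Eh.
have h2 : `|h| <= 2 * t.
  have /andP[t0 _] := t01; rewrite Eh Ep Eq.
  rewrite (le_trans (ler_normD _ _))// mulr2n mulrDl mul1r -[in leRHS](gtr0_norm t0).
  by rewrite lerD// norm_scale_basis.
apply: (@le_trans _ _ (6 * (f (z + h + p) + f (z + h + q) + f (z + p) + f (z + q) + f z
  + \sum_l (fdiffs t [:: i; j] (g l) (z + h) - fdiffs t [:: i; j] (g l) z) ^+ 2))); last first.
  by rewrite ler_wpM2l// lerD2l gC.
rewrite !fg -!big_split/= mulr_sumr; apply: ler_sum => l _.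
set E := fdiff _ _ _ _ - _.
have -> : g l (z + h + p + q) = \sum_(x <- [:: g l (z + h + p); g l (z + h + q);
    - g l (z + p); - g l (z + q); g l z; E]) x.
  rewrite !big_cons big_nil /E /fdiff -Ep -Eq.
  have -> : z + h = z + p + q by rewrite Eh addrA.
  ring.
apply: (le_trans (sqr_sum_le _)).
by rewrite !big_cons big_nil /= !sqrrN; lra.
Qed.

(** Without any cancellation, seven values and the error give the factor 8. *)
Lemma sos_cube i j l : exists C, forall z t p q h, 0 < t <= 1 ->
  p = t *: basis R i -> q = t *: basis R j -> h = t *: basis R l ->
  f (z + h + p + q) <=
    8 * (f (z + h + p) + f (z + h + q) + f (z + h)
         + f (z + p + q) + f (z + p) + f (z + q) + f z + C * t `^ ((minn k 5)%:R + a)).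
Proof.
have [m [g [C [fg gC]]]] := sos_fdiff i j; exists C => z t p q h t01 Ep Eq Eh.
have h2 : `|h| <= 2 * t.
  have /andP[t0 _] := t01; rewrite Eh (le_trans (norm_scale_basis _ _))// gtr0_norm//; lra.
apply: (@le_trans _ _ (8 * (f (z + h + p) + f (z + h + q) + f (z + h)
  + f (z + p + q) + f (z + p) + f (z + q) + f z
  + \sum_l (fdiffs t [:: i; j] (g l) (z + h) - fdiffs t [:: i; j] (g l) z) ^+ 2))); last first.
  by rewrite ler_wpM2l// lerD2l gC.
rewrite !fg -!big_split/= mulr_sumr; apply: ler_sum => s _.
set E := fdiff _ _ _ _ - _.
have -> : g s (z + h + p + q) = \sum_(x <- [:: g s (z + h + p); g s (z + h + q);
    - g s (z + h); g s (z + p + q); - g s (z + p); - g s (z + q); g s z; E]) x.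
  by rewrite !big_cons big_nil /E /fdiff -Ep -Eq; ring.
apply: (le_trans (sqr_sum_le _)).
by rewrite !big_cons big_nil /= !sqrrN; lra.
Qed.

End SumsOfSquares.

(** * Zooming in at the points 2 pi N *)

Section Rescaling.
Variable R : realType.
Local Open Scope classical_set_scope.

Definition center (N : nat) : R := pi *+ 2 *+ N.

Definition scale (N : nat) : R := (1 + center N ^+ 2)^-1.

(** Sine in units of [scale N]; by periodicity it describes sine both near 0 and near [center N]. *)
Definition sinr (X : R) (N : nat) : R := sin (scale N * X) / scale N.

Definition bumpr (X : R) (N : nat) : R :=
  (1 + (center N + scale N * X) ^+ 2)^-1 / scale N.

Lemma scale_gt0 N : 0 < scale N.
Proof. by rewrite invr_gt0 oneDsqr_gt0. Qed.

Lemma scale_le1 N : scale N <= 1.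
Proof. by have := bump_le1 (center N); rewrite ger0_norm// ltW ?scale_gt0. Qed.

Lemma cvg_scale : scale n @[n --> \oo] --> (0 : R).
Proof.
(* Comparison with the harmonic sequence, as (2 pi N)^2 >= N. *)
apply: (@squeeze_cvgr _ _ _ _ (fun=> 0) (fun n => n.+1%:R^-1)); last 2 first.
- exact: cvg_cst.
- exact: cvg_harmonic.
apply: nearW => N; rewrite ltW ?scale_gt0//= lef_pV2 ?posrE ?oneDsqr_gt0 ?ltr0n//.
rewrite -natr1 addrC lerD2l /center.
have pi2 := pi_ge2 R; rewrite -[pi *+ 2 *+ N]mulr_natr -[pi *+ 2]mulr_natr exprMn -natrX.
have [->|N0] := posnP N; first by apply: mulr_ge0; rewrite ?sqr_ge0.
have h1 : N%:R <= (N ^ 2)%:R :> R by rewrite ler_nat; nia.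
have h2 : 1 <= (pi * 2 : R) ^+ 2 by rewrite expr_ge1//; lra.
by apply: (le_trans h1); rewrite ler_peMl.
Qed.

Lemma cvg_scale_powR (a : R) : 0 < a -> scale n `^ a @[n --> \oo] --> (0 : R).
Proof.
move=> a0; have /cvg_at_rightP := powR_cvg0 a0; apply.
by split; [exact: scale_gt0|exact: cvg_scale].
Qed.

(** For y > 0, sin y - y = y (cos c - 1) with |cos c - 1| <= c <= y. Quadratic order suffices for an
    error of size [scale N] after rescaling. *)
Lemma sin_sub_le (y : R) : `|sin y - y| <= `|y| ^+ 2.
Proof.
wlog y0 : y / 0 < y.
  move=> H; have [y0|y0|<-] := ltgtP 0 y; first exact: H.
    by rewrite -normrN opprB -[y in y - _]opprK addrC -sinN -[`|y|]normrN H ?oppr_gt0.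
  by rewrite sin0 subrr normr0 expr0n.
have [|c] := @MVT _ sin cos 0 y y0 (fun c _ => is_derive_sin c).
  by apply: derivable_within_continuous => c _; exact: (@ex_derive _ _ _ _ _ _ _ (is_derive_sin c)).
rewrite in_itv/= sin0 !subr0 => /andP[c0 cy] ->.
rewrite -{2}[y]mul1r -mulrBl normrM expr2 ler_wpM2r//.
have sl (u : R) : `|- sin u| <= 1 by rewrite normrN ler_norml sin_geN1 sin_le1.
have := lipschitz_line (@is_derive_cos R) sl c 0.
rewrite cos0 subr0 mul1r => /le_trans; apply.
by rewrite !gtr0_norm ?ltW.
Qed.

Lemma sinr_near X N : `|X| <= 1 -> `|sinr X N - X| <= scale N.
Proof.
move=> X1; have t0 := scale_gt0 N; have t1 := scale_le1 N; rewrite /sinr; set t := scale N in t0 t1 *.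
have -> : sin (t * X) / t - X = (sin (t * X) - t * X) / t by field; rewrite gt_eqF.
rewrite normrM [`|t^-1|]gtr0_norm; last by rewrite invr_gt0.
rewrite ler_pdivrMr//.
apply: (le_trans (sin_sub_le _)); rewrite normrM (gtr0_norm t0) -expr2 lerXn2r ?nnegrE ?mulr_ge0 ?(ltW t0)//.
by rewrite ler_piMr ?(ltW t0).
Qed.

Lemma bumpr_near X N : `|X| <= 1 -> `|bumpr X N - 1| <= 3 * scale N.
Proof.
move=> X1; have t0 := scale_gt0 N; have t1 := scale_le1 N.
pose d := scale N * X; pose s := center N + d; pose B := (1 + s ^+ 2)^-1.
(* This is B (center^2 - s^2), factored. Keeping [s * B] together makes the bound uniform in [N]: it
   is at most 1 in absolute value, while [s] grows with [N]. *)
have -> : bumpr X N - 1 = d * (d * B - 2 * (s * B)).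
  have BE : B * (1 + s ^+ 2) = 1 by rewrite mulVf// gt_eqF ?oneDsqr_gt0.
  rewrite /bumpr -/d -/s -/B /scale invrK -[X in _ - X]BE /s; ring.
have dt : `|d| <= scale N by rewrite normrM (gtr0_norm t0) ler_piMr ?(ltW t0).
rewrite normrM mulrC; apply: ler_pM => //.
rewrite (le_trans (ler_normB _ _))// [`|d * B|]normrM [`|2 * _|]normrM normr_nat (_ : 3 = 1 * 1 + 2 * 1 :> R); last by ring.
apply: lerD; last by rewrite ler_wpM2l// odd_bump_le1.
by apply: ler_pM => //; [exact: (le_trans dt t1)|exact: bump_le1].
Qed.

Lemma cvg_near_scale (u : nat -> R) l K : (forall N, `|u N - l| <= K * scale N) ->
  u n @[n --> \oo] --> l.
Proof.
move=> uK; apply/cvgrPdist_le => e e0.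
have : (K * scale n) @[n --> \oo] --> (0 : R).
  by rewrite -(mulr0 K); apply: cvgM; [exact: cvg_cst|exact: cvg_scale].
move=> /cvgrPdist_le/(_ e e0); apply: filterS => N.
rewrite sub0r normrN => /(le_trans (ler_norm _)) H.
by rewrite distrC (le_trans (uK N)).
Qed.

Lemma cvg_sinr X : `|X| <= 1 -> sinr X n @[n --> \oo] --> X.
Proof. by move=> X1; apply: (@cvg_near_scale _ _ 1) => N; rewrite mul1r sinr_near. Qed.

Lemma cvg_bumpr X : `|X| <= 1 -> bumpr X n @[n --> \oo] --> (1 : R).
Proof. by move=> X1; apply: (@cvg_near_scale _ _ 3) => N; apply: bumpr_near. Qed.

End Rescaling.

(** * The two functions and their behaviour at scale t near the centers *)

Section Examples.
Variables (R : realType) (n : nat).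
Implicit Types (x : 'rV[R]_n) (i j l : 'I_n).
Local Open Scope classical_set_scope.

(** The bump reads the same coordinate as the first sine, so the parameter [w] costs no further
    dimension. *)
Definition hexagon_fun i j x : R :=
  hexagon_poly (sin (x ord0 i)) (sin (x ord0 j)) (1 + x ord0 i ^+ 2)^-1.

Definition cube_fun i j l x : R :=
  cube_poly (sin (x ord0 i)) (sin (x ord0 j)) (sin (x ord0 l)) (1 + x ord0 i ^+ 2)^-1.

Lemma tame_hexagon i j : tame (hexagon_fun i j).
Proof.
rewrite /hexagon_fun /hexagon_poly /hexagon_tail.
by repeat first [exact: tame_cst | exact: tame_sin | exact: tame_bump | apply: tame_exp
  | apply: tame_opp | apply: tame_add | apply: tame_mul].
Qed.

Lemma tame_cube i j l : tame (cube_fun i j l).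
Proof.
rewrite /cube_fun /cube_poly.
by repeat first [exact: tame_cst | exact: tame_sin | exact: tame_bump | apply: tame_exp
  | apply: tame_opp | apply: tame_add | apply: tame_mul].
Qed.

Lemma sin_norm_le1 (u : R) : `|sin u| <= 1.
Proof. by rewrite ler_norml sin_geN1 sin_le1. Qed.

Lemma hexagon_fun_ge0 i j x : 0 <= hexagon_fun i j x.
Proof.
apply: hexagon_poly_ge0; rewrite ?sin_norm_le1// invr_gt0 oneDsqr_gt0/=.
by have := bump_le1 (x ord0 i); rewrite ler_norml => /andP[].
Qed.

Lemma cube_fun_ge0 i j l x : 0 <= cube_fun i j l x.
Proof. by apply: cube_poly_ge0; rewrite invr_gt0 oneDsqr_gt0. Qed.

Lemma sin_center (X : R) N : sin (center R N + scale R N * X) = scale R N * sinr X N.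
Proof.
rewrite addrC /center (periodicn (@sinD2pi R)) /sinr [RHS]mulrC divfK//.
by rewrite gt_eqF ?scale_gt0.
Qed.

Lemma sin_scale (X : R) N : sin (scale R N * X) = scale R N * sinr X N.
Proof. by rewrite /sinr [RHS]mulrC divfK// gt_eqF ?scale_gt0. Qed.

Lemma bump_center (X : R) N :
  (1 + (center R N + scale R N * X) ^+ 2)^-1 = scale R N * bumpr X N.
Proof. by rewrite /bumpr [RHS]mulrC divfK// gt_eqF ?scale_gt0. Qed.

(** The tail is homogeneous of degree 5, and the square is dropped. This serves the top vertex,
    where a lower bound is wanted. *)
Lemma hexagon_fun_ge i j x N X Y :
  x ord0 i = center R N + scale R N * X -> x ord0 j = scale R N * Y ->
  scale R N ^+ 5 * hexagon_tail (sinr X N) (sinr Y N) (bumpr X N) <= hexagon_fun i j x.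
Proof.
move=> xi xj; rewrite /hexagon_fun xi xj sin_center sin_scale bump_center.
have -> t u v w : t ^+ 5 * hexagon_tail u v w = hexagon_tail (t * u) (t * v) (t * w).
  by rewrite /hexagon_tail; ring.
by rewrite /hexagon_poly lerDr mulr_ge0// sqr_ge0.
Qed.

(** On the ellipse the square contributes t^4 q^2 with q = O(t), one power of t beyond the tail. *)
Lemma hexagon_fun_le i j x N X Y :
  x ord0 i = center R N + scale R N * X -> x ord0 j = scale R N * Y ->
  `|X| <= 1 -> `|Y| <= 1 -> X ^+ 2 - X * Y + Y ^+ 2 = 1 ->
  hexagon_fun i j x <= scale R N ^+ 5 *
    (1024 * 24 ^+ 2 * scale R N + hexagon_tail (sinr X N) (sinr Y N) (bumpr X N)).
Proof.
move=> xi xj X1 Y1 XY; rewrite /hexagon_fun xi xj sin_center sin_scale bump_center.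
have := sinr_near N X1; have := sinr_near N Y1; have := bumpr_near N X1.
set u := sinr X N; set v := sinr Y N; set w := bumpr X N; set t := scale R N.
have t0 : 0 < t := scale_gt0 R N; have t1 : t <= 1 := scale_le1 R N.
move=> wt vt ut.
rewrite /hexagon_poly.
have -> : hexagon_tail (t * u) (t * v) (t * w) = t ^+ 5 * hexagon_tail u v w.
  by rewrite /hexagon_tail; ring.
rewrite [t ^+ 5 * (_ + _)]mulrDr lerD2r.
set q := u ^+ 2 - u * v + v ^+ 2 - w ^+ 2.
suff qt : `|q| <= 24 * t.
  have : q ^+ 2 <= (24 * t) ^+ 2.
    by rewrite -[q ^+ 2]real_normK ?num_real// lerXn2r// nnegrE mulr_ge0// ltW.
  move=> /(ler_wpM2l (exprn_ge0 4 (ltW t0))) H.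
  have -> : (t * u) ^+ 2 - t * u * (t * v) + (t * v) ^+ 2 - (t * w) ^+ 2 = t ^+ 2 * q.
    by rewrite /q; ring.
  have -> : 1024 * (t ^+ 2 * q) ^+ 2 = 1024 * (t ^+ 4 * q ^+ 2) by ring.
  have -> : t ^+ 5 * (1024 * 24 ^+ 2 * t) = 1024 * (t ^+ 4 * (24 * t) ^+ 2) by ring.
  by rewrite ler_wpM2l.
(* Expansion around (X, Y, 1): every product has a factor O(t), and the bounds below add up to 3 + 2
   + 1 + 3 + 15 = 24. *)
have -> : q = (u - X) * (u - X + 2 * X) - (u - X) * (v - Y + Y) - (v - Y) * X
    + (v - Y) * (v - Y + 2 * Y) - (w - 1) * (w - 1 + 2).
  by rewrite -[LHS]subr0 -(subrr 1) -{1}XY /q; ring.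
have prod A B p r : `|p| <= A * t -> `|r| <= B -> `|p * r| <= A * t * B.
  by move=> pA rB; rewrite normrM ler_pM.
have ub : `|u - X| <= 1 * t by rewrite mul1r.
have vb : `|v - Y| <= 1 * t by rewrite mul1r.
have := X1; have := Y1; have := wt; have := vt; have := ut; rewrite !ler_norml.
move=> /andP[u1 u2] /andP[v1 v2] /andP[w1 w2] /andP[Y2 Y3] /andP[X2 X3].
have h1 : `|(u - X) * (u - X + 2 * X)| <= 1 * t * 3.
  by apply: prod => //; rewrite ler_norml; apply/andP; split; lra.
have h2 : `|(u - X) * (v - Y + Y)| <= 1 * t * 2.
  by apply: prod => //; rewrite ler_norml; apply/andP; split; lra.
have h3 : `|(v - Y) * X| <= 1 * t * 1 by apply: prod.
have h4 : `|(v - Y) * (v - Y + 2 * Y)| <= 1 * t * 3.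
  by apply: prod => //; rewrite ler_norml; apply/andP; split; lra.
have h5 : `|(w - 1) * (w - 1 + 2)| <= 3 * t * 5.
  by apply: prod => //; rewrite ler_norml; apply/andP; split; lra.
move: h1 h2 h3 h4 h5; rewrite !ler_norml.
move=> /andP[? ?] /andP[? ?] /andP[? ?] /andP[? ?] /andP[? ?].
by apply/andP; split; lra.
Qed.

End Examples.

(** * Passage to the limit and contradiction *)

Section NotSumsOfSquares.
Variables (R : realType) (n : nat).
Implicit Types (x : 'rV[R]_n) (i j l : 'I_n).
Local Open Scope classical_set_scope.

Lemma cvg_exp p (s : nat -> R) (S : R) :
  s m @[m --> \oo] --> S -> s m ^+ p @[m --> \oo] --> S ^+ p.
Proof.
move=> sS; elim: p => [|p IH].
  by under eq_cvg do rewrite expr0; rewrite expr0; exact: cvg_cst.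
by under eq_cvg do rewrite exprS; rewrite exprS; apply: cvgM.
Qed.

Lemma cvg_hexagon_tail (u v w : nat -> R) (X Y W : R) :
  u m @[m --> \oo] --> X -> v m @[m --> \oo] --> Y -> w m @[m --> \oo] --> W ->
  hexagon_tail (u m) (v m) (w m) @[m --> \oo] --> hexagon_tail X Y W.
Proof.
move=> uX vY wW.
have uv : (u m + v m) @[m --> \oo] --> X + Y by apply: cvgD.
rewrite /hexagon_tail; apply: cvgD; last exact: cvg_exp.
apply: cvgM; last by apply: cvgD => //; apply: cvgM => //; exact: cvg_cst.
by apply: cvg_exp; apply: cvgB; [exact: cvg_exp uv|exact: cvg_exp wW].
Qed.

Lemma cvg_cube_poly (u v z w : nat -> R) (X Y Z W : R) :
  u m @[m --> \oo] --> X -> v m @[m --> \oo] --> Y -> z m @[m --> \oo] --> Z ->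
  w m @[m --> \oo] --> W ->
  cube_poly (u m) (v m) (z m) (w m) @[m --> \oo] --> cube_poly X Y Z W.
Proof.
move=> uX vY zZ wW.
have sq (s : nat -> R) (S : R) : s m @[m --> \oo] --> S ->
    (s m * (s m - w m)) ^+ 2 @[m --> \oo] --> (S * (S - W)) ^+ 2.
  move=> sS; under eq_cvg do rewrite expr2; rewrite expr2.
  by apply: cvgM; apply: cvgM => //; apply: cvgB.
rewrite /cube_poly; apply: cvgD; last exact: cvg_exp.
apply: cvgD; apply: cvgM; [exact: cvg_cst| | |].
- by apply: cvgD; [apply: cvgD|]; apply: sq.
- by apply: cvgM => //; exact: cvg_cst.
- by apply: cvgM => //; apply: cvgM.
Qed.

(** [cube_poly] is homogeneous of degree 4, so rescaling is exact; [hexagon_poly] mixes degrees 4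
    and 5 and only admits bounds. *)
Lemma cube_fun_rescaled i j l x N X Y Z :
  x ord0 i = center R N + scale R N * X -> x ord0 j = scale R N * Y ->
  x ord0 l = scale R N * Z ->
  cube_fun i j l x =
    scale R N ^+ 4 * cube_poly (sinr X N) (sinr Y N) (sinr Z N) (bumpr X N).
Proof.
move=> xi xj xl; rewrite /cube_fun xi xj xl sin_center !sin_scale bump_center.
by rewrite /cube_poly; ring.
Qed.

(** Divided by t^5, the inequality of [sos_hexagon] has an error C t^a that vanishes in the limit,
    where it would read 37 <= 30. *)
Lemma hexagon_not_sos k a i j : i != j -> 0 < a <= 1 -> (5 <= k)%N ->
  ~ finite_sum_of_squares (half_regular k a) (hexagon_fun (R := R) i j).
Proof.
move=> ij a01 k5 sos; have [a0 _] := andP a01.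
have [C HC] := sos_hexagon a01 (ltnW k5) (tame_bounded (tame_hexagon R i j)) sos i j.
pose T (X Y : R) N := hexagon_tail (sinr X N) (sinr Y N) (bumpr X N).
have cT X Y : `|X| <= 1 -> `|Y| <= 1 -> T X Y m @[m --> \oo] --> hexagon_tail X Y 1.
  by move=> X1 Y1; apply: cvg_hexagon_tail; [exact: cvg_sinr|exact: cvg_sinr|exact: cvg_bumpr].
have n1 : `|1 : R| <= 1 by rewrite normr1.
have n0 : `|0 : R| <= 1 by rewrite normr0.
have nN1 : `|-1 : R| <= 1 by rewrite normrN1.
pose K : R := 1024 * 24 ^+ 2.
(* After division by t^5, [T] bounds the function from below and [U] bounds it from above on the
   ellipse; their gap tends to 0. *)
pose U (X Y : R) N := K * scale R N + T X Y N.
have cU X Y : `|X| <= 1 -> `|Y| <= 1 -> U X Y m @[m --> \oo] --> hexagon_tail X Y 1.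
  move=> X1 Y1; rewrite -[hexagon_tail X Y 1]add0r -(mulr0 K).
  by apply: cvgD; [apply: cvgM; [exact: cvg_cst|exact: cvg_scale]|exact: cT].
have key N : T 1 1 N <= 6 * (U 1 0 N + U 0 1 N + U 0 (-1) N + U (-1) 0 N + U (-1) (-1) N
    + C * scale R N `^ a).
  set t := scale R N; have t0 : 0 < t := scale_gt0 R N.
  have t01 : 0 < t <= 1 by rewrite t0 scale_le1.
  (* This puts the cancelled point z + p + q at the center; in units of t the other six are (1, 1),
     (1, 0), (0, 1), (0, -1), (-1, 0) and (-1, -1). *)
  pose z := (center R N - t) *: basis R i - t *: basis R j.
  have := HC z t _ _ _ t01 erefl erefl erefl.
  rewrite (minn_idPr k5) powRD; last by rewrite (gt_eqF t0) implybT.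
  rewrite powR_mulrn ?(ltW t0)// => H; rewrite -(ler_pM2l (exprn_gt0 5 t0)).
  have ji : (j == i) = false by rewrite eq_sym; exact: negbTE.
  have coord := (mxE, eqxx, ji, negbTE ij).
  apply: le_trans (le_trans H _).
    by apply: hexagon_fun_ge; rewrite /z !coord/= -/t; ring.
  have hle X Y x : `|X| <= 1 -> `|Y| <= 1 -> X ^+ 2 - X * Y + Y ^+ 2 = 1 ->
      x ord0 i = center R N + t * X -> x ord0 j = t * Y ->
      hexagon_fun i j x <= t ^+ 5 * U X Y N.
    by move=> X1 Y1 XY xi xj; apply: hexagon_fun_le.
  have dist (u1 u2 u3 u4 u5 u6 : R) : t ^+ 5 * (u1 + u2 + u3 + u4 + u5 + u6) =
      t ^+ 5 * u1 + t ^+ 5 * u2 + t ^+ 5 * u3 + t ^+ 5 * u4 + t ^+ 5 * u5 + t ^+ 5 * u6.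
    by ring.
  rewrite [leRHS]mulrCA ler_wpM2l// dist.
  have -> : C * (t ^+ 5 * t `^ a) = t ^+ 5 * (C * t `^ a) by ring.
  rewrite lerD2r; apply: lerD; [apply: lerD; [apply: lerD; [apply: lerD|]|]|].
  - by apply: hle => //; rewrite /z ?coord/=; ring.
  - by apply: hle => //; rewrite /z ?coord/=; ring.
  - by apply: hle => //; rewrite /z ?coord/=; ring.
  - by apply: hle => //; rewrite /z ?coord/=; ring.
  - by apply: hle => //; rewrite /z ?coord/=; ring.
have : hexagon_tail 1 1 1 <= 6 * (hexagon_tail 1 0 1 + hexagon_tail 0 1 1 + hexagon_tail 0 (-1) 1
    + hexagon_tail (-1) 0 1 + hexagon_tail (-1) (-1) 1 + C * 0) :> R.
  apply: (ler_cvg_to (cT _ _ n1 n1) _ (nearW _ key)).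
  apply: cvgM; first exact: cvg_cst.
  apply: cvgD; last by apply: cvgM; [exact: cvg_cst|exact: cvg_scale_powR].
  by apply: cvgD; [apply: cvgD; [apply: cvgD; [apply: cvgD|]|]|]; exact: cU.
by rewrite /hexagon_tail; lra.
Qed.

(** Divided by t^4, the inequality of [sos_cube] would become 61 <= 56 in the limit. *)
Lemma cube_not_sos a i j l : i != j -> i != l -> j != l -> 0 < a <= 1 ->
  ~ finite_sum_of_squares (half_regular 4 a) (cube_fun (R := R) i j l).
Proof.
move=> ij il jl a01 sos; have [a0 _] := andP a01.
have [C HC] := sos_cube a01 (leqnn 4) (tame_bounded (tame_cube R i j l)) sos i j l.
pose T (X Y Z : R) N := cube_poly (sinr X N) (sinr Y N) (sinr Z N) (bumpr X N).
have n1 : `|1 : R| <= 1 by rewrite normr1.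
have n0 : `|0 : R| <= 1 by rewrite normr0.
have cT X Y Z : `|X| <= 1 -> `|Y| <= 1 -> `|Z| <= 1 ->
    T X Y Z m @[m --> \oo] --> cube_poly X Y Z 1.
  move=> X1 Y1 Z1.
  by apply: cvg_cube_poly; [exact: cvg_sinr|exact: cvg_sinr|exact: cvg_sinr|exact: cvg_bumpr].
have key N : T 1 1 1 N <= 8 * (T 1 0 1 N + T 0 1 1 N + T 0 0 1 N + T 1 1 0 N + T 1 0 0 N
    + T 0 1 0 N + T 0 0 0 N + C * scale R N `^ a).
  set t := scale R N; have t0 : 0 < t := scale_gt0 R N.
  have t01 : 0 < t <= 1 by rewrite t0 scale_le1.
  (* The base point is the vertex (0, 0, 0), so all eight points have rescaled coordinates 0 or
     1. *)
  have := HC (center R N *: basis R i) t _ _ _ t01 erefl erefl erefl.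
  rewrite powRD; last by rewrite (gt_eqF t0) implybT.
  have ji : (j == i) = false by rewrite eq_sym; exact: negbTE.
  have li : (l == i) = false by rewrite eq_sym; exact: negbTE.
  have lj : (l == j) = false by rewrite eq_sym; exact: negbTE.
  have coord := (mxE, eqxx, ji, li, lj, negbTE ij, negbTE il, negbTE jl).
  rewrite (@cube_fun_rescaled _ _ _ _ N 1 1 1); try by rewrite !coord/= -/t; ring.
  rewrite (@cube_fun_rescaled _ _ _ _ N 1 0 1); try by rewrite !coord/= -/t; ring.
  rewrite (@cube_fun_rescaled _ _ _ _ N 0 1 1); try by rewrite !coord/= -/t; ring.
  rewrite (@cube_fun_rescaled _ _ _ _ N 0 0 1); try by rewrite !coord/= -/t; ring.
  rewrite (@cube_fun_rescaled _ _ _ _ N 1 1 0); try by rewrite !coord/= -/t; ring.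
  rewrite (@cube_fun_rescaled _ _ _ _ N 1 0 0); try by rewrite !coord/= -/t; ring.
  rewrite (@cube_fun_rescaled _ _ _ _ N 0 1 0); try by rewrite !coord/= -/t; ring.
  rewrite (@cube_fun_rescaled _ _ _ _ N 0 0 0); try by rewrite !coord/= -/t; ring.
  rewrite powR_mulrn ?(ltW t0)// [C * (_ * _)]mulrCA -!mulrDr mulrCA ler_pM2l//.
  exact: exprn_gt0.
have : cube_poly 1 1 1 1 <= 8 * (cube_poly 1 0 1 1 + cube_poly 0 1 1 1 + cube_poly 0 0 1 1
    + cube_poly 1 1 0 1 + cube_poly 1 0 0 1 + cube_poly 0 1 0 1 + cube_poly 0 0 0 1 + C * 0) :> R.
  apply: (ler_cvg_to (cT _ _ _ n1 n1 n1) _ (nearW _ key)).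
  apply: cvgM; first exact: cvg_cst.
  apply: cvgD; last by apply: cvgM; [exact: cvg_cst|exact: cvg_scale_powR].
  apply: cvgD; [apply: cvgD; [apply: cvgD; [apply: cvgD; [apply: cvgD; [apply: cvgD|]|]|]|]|];
    exact: cT.
by rewrite /cube_poly; lra.
Qed.

End NotSumsOfSquares.

Theorem corollary4p4 (R : realType) (k n : nat) (hk : (4 <= k)%N)
    (hn : (2 <= n)%N) (hkn : (4 < k)%N \/ (2 < n)%N)
    (a : R) (ha0 : 0 < a) (ha1 : a <= 1) :
  exists f : 'rV[R]_n -> R,
    [/\ holder_space k a f, forall x, 0 <= f x
      & ~ finite_sum_of_squares (half_regular k a) f].
Proof.
have a01 : 0 < a <= 1 by rewrite ha0.
pose i0 := Ordinal (ltnW hn); pose i1 := Ordinal hn.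
(* Only [k = 4] calls for the cube, and there [hkn] forces [2 < n], which supplies the third
   coordinate. *)
have [k5|k4] := leqP 5 k.
  exists (hexagon_fun i0 i1); split; first exact: tame_holder_space (tame_hexagon _ _ _).
    exact: hexagon_fun_ge0.
  exact: hexagon_not_sos.
have k4' : k = 4 by lia.
have n3 : (2 < n)%N by case: hkn => //; lia.
pose i2 := Ordinal n3.
exists (cube_fun i0 i1 i2); split; first exact: tame_holder_space (tame_cube _ _ _ _).
  exact: cube_fun_ge0.
by rewrite k4'; exact: cube_not_sos.
Qed.
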